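(* Let $V=\mathbb{R}^{2n+1}$ and let $\mathfrak{g}\subset\mathfrak{gl}(2n+1,\mathbb{R})=V^*\otimes V$ be the Lie algebra $\mathfrak{g}=\iota_*\mathfrak{gl}(n,\mathbb{R})$ of the image $G$ of the Lie-group monomorphism $$\iota\colon Gl(n,\mathbb{R})\to Gl(2n+1,\mathbb{R}),\qquad \iota(\Lambda)=\begin{pmatrix}1&0&0\\0&\Lambda&0\\0&0&\Lambda\end{pmatrix}.$$ Then the first prolongation of $\mathfrak{g}$ vanishes: $\mathfrak{g}^{(1)}=(S^2V^*\otimes V)\cap(V^*\otimes\mathfrak{g})=\{0\}$.
   Context: $n\ge1$ is an integer. Both $S^2V^*\otimes V$ (symmetric bilinear maps $V\times V\to V$) and $V^*\otimes\mathfrak{g}$ (linear maps $V\to\mathfrak{g}$) are regarded as subspaces of $V^*\otimes V^*\otimes V$, the space of bilinear maps $V\times V\to V$. Explicitly, $\mathfrak{g}$ consists of the block-diagonal matrices $\mathrm{diag}(0,A,A)$ with $A\in\mathfrak{gl}(n,\mathbb{R})$. *)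

(* Defs.v *)
From HB Require Import structures.
From mathcomp Require Import all_boot all_order all_algebra.
From mathcomp Require Import all_classical all_reals all_analysis.

Set Implicit Arguments.
Unset Strict Implicit.
Unset Printing Implicit Defensive.

Import Order.TTheory GRing.Theory Num.Theory.
Import numFieldNormedType.Exports.

Local Open Scope classical_set_scope.
Local Open Scope ring_scope.

Section Prolongation.
Variables (R : realType) (m : nat).

Local Notation V := 'cV[R]_m.

(* V^* (x) V^* (x) V, the space of bilinear maps V x V -> V, in curried form. *)
Definition bilin := 'Hom(V, 'Hom(V, V)).

Definition sym2_tensor : set bilin :=
  [set B : bilin | forall u v : V, B u v = B v u].

(* V^* (x) g, for g a set of matrices acting on column vectors from the left;
   a linear map L : V -> g is identified with the bilinear map L u *m v. *)
Definition dual_tensor (g : set 'M[R]_m) : set bilin :=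
  [set B : bilin | exists L : {linear V -> 'M[R]_m},
     (forall u, g (L u)) /\ (forall u v : V, B u v = L u *m v)].

Definition first_prolongation (g : set 'M[R]_m) : set bilin :=
  sym2_tensor `&` dual_tensor g.

End Prolongation.

Section Iota.
Variables (R : realType) (n : nat).

(* The size 2n+1 is written 1 + (n + n), along the block decomposition.
   The formula makes sense on all of gl(n), in which Gl(n) is open, so that the
   differential at the identity is the one of the restriction to Gl(n). *)
Definition iota (L : 'M[R]_n) : 'M[R]_(1 + (n + n)) :=
  block_mx 1%:M 0 0 (block_mx L 0 0 L).

Definition iota_push : 'M[R]_n -> 'M[R]_(1 + (n + n)) :=
  'd iota (1%:M : 'M[R]_n).

(* iota_* gl(n, R) *)
Definition iota_lie : set 'M[R]_(1 + (n + n)) := range iota_push.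

Definition diag0 (A : 'M[R]_n) : 'M[R]_(1 + (n + n)) :=
  block_mx 0 0 0 (block_mx A 0 0 A).

Lemma diag0_is_linear : linear diag0.
Proof.
by move=> a A B; rewrite /diag0 !scale_block_mx !add_block_mx !scaler0 !addr0.
Qed.

HB.instance Definition _ := GRing.isLinear.Build _ _ _ _ diag0 diag0_is_linear.

Lemma diag0_continuous : continuous diag0.
Proof.
apply: bounded_linear_continuous; apply/linear_boundedP.
exists 1; split; first exact: real1.
move=> M M1 A; apply: le_trans (ler_peMl _ (ltW M1)); last exact: normr_ge0.
rewrite [leLHS]/Num.norm /= mx_normrE.
apply: bigmax_le => [|ij _]; first exact: normr_ge0.
have entry k l : `|A k l| <= `|A|.
  rewrite [leRHS]/Num.norm /= mx_normrE.
  exact: (@le_bigmax _ _ _ _ (fun x => `|A x.1 x.2|) (k, l)).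
move: ij.1 ij.2 => i j; rewrite !mxE.
case: fintype.split => i1; rewrite mxE; case: fintype.split => j1;
  rewrite ?mxE ?normr0 //.
by case: fintype.split => i2; rewrite mxE; case: fintype.split => j2;
  rewrite ?mxE ?normr0.
Qed.

Lemma iota_pushE (A : 'M[R]_n) :
  iota_push A = block_mx 0 0 0 (block_mx A 0 0 A).
Proof.
rewrite /iota_push.
have -> : iota = cst (block_mx 1%:M 0 0 0) + diag0.
  apply/funext => L; rewrite /iota /cst /diag0.
  by rewrite [RHS]add_block_mx !addr0 !add0r.
have dl : differentiable diag0 (1%:M : 'M[R]_n).
  exact: linear_differentiable diag0_continuous.
have dE : 'd diag0 (1%:M : 'M[R]_n) = diag0 :> (_ -> _).
  exact: diff_lin diag0_continuous.
have dd : is_diff (1%:M : 'M[R]_n) diag0 diag0 by exact: DiffDef dl dE.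
have dc : is_diff (1%:M : 'M[R]_n)
    (cst (block_mx 1%:M 0 0 0 : 'M[R]_(1 + (n + n)))) 0.
  exact: is_diff_cst.
have ds := is_diffD dc dd.
have e0 : (0 + diag0) A = diag0 A by exact: add0r.
exact: etrans (congr1 (@^~ A) (@diff_val _ _ _ _ _ _ _ ds)) e0.
Qed.

Lemma iota_lieE :
  iota_lie = [set block_mx 0 0 0 (block_mx A 0 0 A) | A in [set: 'M[R]_n]].
Proof. by rewrite /iota_lie (funext iota_pushE). Qed.

End Iota.

Arguments iota_lie R n : clear implicits.

(* Main.v *)
Require Import Defs.
From HB Require Import structures.
From mathcomp Require Import all_boot all_order all_algebra.
From mathcomp Require Import all_classical all_reals all_analysis.
Import Order.TTheory GRing.Theory Num.Theory.
Import numFieldNormedType.Exports.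
Local Open Scope classical_set_scope.
Local Open Scope ring_scope.

(** Write [V = R (+) W (+) W] with [W = R^n], and let [B] be in the first
    prolongation, so that [B u] is a matrix [diag0 (A u)] for every [u].  It
    preserves each of the two copies of [W] and acts on both as [A u].  So if
    [y] and [y'] are the last components of [u] and [v], the last components of
    [B v u] and [B u v] are [A v *m y] and [A u *m y'].  By symmetry they agree;
    hence if [y' = 0], then [A v *m y = 0] for all [y], that is, [A v = 0] and
    [B v = 0] ([prolongation_last0]).  The middle components give [B v = 0] in
    the same way when the middle component of [v] vanishes
    ([prolongation_mid0]).  Every vector is a sum of two vectors of these kinds,
    so [B = 0]. *)

Lemma mulmx_cV_eq0 (R : pzSemiRingType) (m n : nat) (A : 'M[R]_(m, n)) :
  (forall x : 'cV_n, A *m x = 0) -> A = 0.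
Proof.
move=> A0; apply/matrixP=> i j.
by have /matrixP/(_ i 0) := A0 (delta_mx j 0); rewrite -colE !mxE.
Qed.

Lemma diag0_mul_col (R : realType) (n : nat) (A : 'M[R]_n)
    (a : 'cV[R]_1) (x y : 'cV[R]_n) :
  diag0 A *m col_mx a (col_mx x y) = col_mx 0 (col_mx (A *m x) (A *m y)).
Proof. by rewrite /diag0 !mul_block_col !mul0mx !addr0 !add0r. Qed.

Section ProlongationOfIotaLie.
Variables (R : realType) (n : nat) (B : bilin R (1 + (n + n))).
Hypothesis B_prol : first_prolongation (iota_lie R n) B.

Lemma prolongation_sym u v : B u v = B v u.
Proof. by case: B_prol => + _; apply. Qed.

Lemma prolongation_diag0 u : exists A : 'M[R]_n, forall v, B u v = diag0 A *m v.
Proof.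
case: B_prol => _ [L [gL BL]].
have := gL u; rewrite iota_lieE => -[A _ LA].
by exists A => v; rewrite BL -LA.
Qed.

(** Testing against the vectors [(0, 0, y)] suffices: by symmetry, the last
    component [A *m y] of the value is also the value of another matrix at the
    vanishing last component of the argument. *)
Lemma prolongation_last0 a x : B (col_mx a (col_mx x 0)) = 0.
Proof.
have [A BA] := prolongation_diag0 (col_mx a (col_mx x 0)).
suff A0 : A = 0 by apply/lfunP=> v; rewrite BA A0 linear0 mul0mx lfunE.
apply: mulmx_cV_eq0 => y.
have := prolongation_sym (col_mx a (col_mx x 0)) (col_mx 0 (col_mx 0 y)).
have [A' BA'] := prolongation_diag0 (col_mx 0 (col_mx 0 y)).
rewrite BA BA' !diag0_mul_col => /eq_col_mx[_] /eq_col_mx[_ ->].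
by rewrite mulmx0.
Qed.

Lemma prolongation_mid0 a y : B (col_mx a (col_mx 0 y)) = 0.
Proof.
have [A BA] := prolongation_diag0 (col_mx a (col_mx 0 y)).
suff A0 : A = 0 by apply/lfunP=> v; rewrite BA A0 linear0 mul0mx lfunE.
apply: mulmx_cV_eq0 => x.
have := prolongation_sym (col_mx a (col_mx 0 y)) (col_mx 0 (col_mx x 0)).
have [A' BA'] := prolongation_diag0 (col_mx 0 (col_mx x 0)).
rewrite BA BA' !diag0_mul_col => /eq_col_mx[_] /eq_col_mx[-> _].
by rewrite mulmx0.
Qed.

Lemma prolongation_eq0 : B = 0.
Proof.
apply/lfunP=> u; rewrite lfunE /= -[u]vsubmxK -[dsubmx u]vsubmxK.
set a := usubmx u; set x := usubmx _; set y := dsubmx _.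
have -> : col_mx a (col_mx x y) =
    col_mx a (col_mx x 0) + col_mx 0 (col_mx 0 y).
  by rewrite !add_col_mx !addr0 !add0r.
by rewrite linearD /= prolongation_last0 prolongation_mid0 addr0.
Qed.

End ProlongationOfIotaLie.

Lemma prolongation_0 (R : realType) (m : nat) (g : set 'M[R]_m) :
  g 0 -> first_prolongation g 0.
Proof.
move=> g0; split=> [u v|]; first by do 2!rewrite lfunE /= lfunE /=.
by exists \0; split=> // u v; rewrite lfunE /= lfunE mul0mx.
Qed.

Theorem proposition3p4 (R : realType) (n : nat) (n_ge1 : (1 <= n)%N) :
  first_prolongation (iota_lie R n) = [set 0].
Proof.
apply/seteqP; split=> [B /prolongation_eq0 //|_ ->].
apply: prolongation_0; rewrite iota_lieE.
by exists 0 => //; exact: (linear0 (@diag0 R n)).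
Qed.
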